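(* Let $\mathcal{G}=\langle\mathcal{H},\mathcal{E}\rangle$ be a quantum Markov chain and let $T_{\mathcal{E}}:=\mathcal{E}_\infty(\mathcal{H})^\perp$ be the ortho-complement in $\mathcal{H}$ of the image of $\mathcal{H}$ under the asymptotic average $\mathcal{E}_\infty$ of $\mathcal{E}$. Then $T_{\mathcal{E}}$ is the largest transient subspace in $\mathcal{G}$; that is, $T_{\mathcal{E}}$ is transient and any transient subspace of $\mathcal{G}$ is a subspace of $T_{\mathcal{E}}$.
   Context: $\mathcal{H}$ is a (nonzero) finite-dimensional complex Hilbert space. $\mathcal{D}(\mathcal{H})$ is the set of positive semidefinite operators $\rho$ with $\mathrm{tr}(\rho)\le 1$. $\mathrm{supp}(\rho)$ is the span of the eigenvectors of $\rho$ with nonzero eigenvalue. A quantum Markov chain is a pair $\langle\mathcal{H},\mathcal{E}\rangle$ with $\mathcal{E}$ a trace-preserving completely positive linear map on the operators on $\mathcal{H}$. For a completely positive map $\mathcal{F}$ and a subspace $X$, the image $\mathcal{F}(X)$ is the span of all $\mathrm{supp}(\mathcal{F}(|\psi\rangle\langle\psi|))$ with $|\psi\rangle\in X$. The asymptotic average of $\mathcal{E}$ is $\mathcal{E}_\infty=\lim_{N\to\infty}\frac1N\sum_{n=1}^N\mathcal{E}^n$ (the limit exists and is again a trace-preserving completely positive map). A subspace $X\subseteq\mathcal{H}$ is transient in $\mathcal{G}$ if $\lim_{k\to\infty}\mathrm{tr}(P_X\mathcal{E}^k(\rho))=0$ for every $\rho\in\mathcal{D}(\mathcal{H})$, where $P_X$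 is the orthogonal projection onto $X$. *)

(* Defs.v *)
From HB Require Import structures.
From mathcomp Require Import all_boot all_order all_algebra.
From mathcomp Require Import sesquilinear spectral complex.
From mathcomp Require Import all_classical all_reals all_analysis.

Set Implicit Arguments.
Unset Strict Implicit.
Unset Printing Implicit Defensive.

Import Order.TTheory GRing.Theory Num.Theory Num.Def.
Import numFieldNormedType.Exports.

Local Open Scope classical_set_scope.
Local Open Scope ring_scope.
Local Open Scope sesquilinear_scope.

(* As in spectral.v, the Hilbert space C^n is 'rV[C]_n with inner product     *)
(* dotmx (linear in its first argument), an operator is a matrix acting on    *)
(* row vectors by right multiplication, and a subspace is a row space, whose  *)
(* matrix representative matters only up to (_ :=: _)%MS.                     *)
(* The definitions are meant for C := R[i] with R : realType; an abstract C   *)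
(* makes the topology of numFieldNormedType available on C and 'M[C]_n.       *)

Section QuantumMarkovChain.
Context {C : numClosedFieldType} {n : nat}.

Definition span_set (S : set 'rV[C]_n) : 'M[C]_n :=
  xget 0 [set U : 'M[C]_n | forall v : 'rV[C]_n, (v <= U)%MS <->
    exists m (B : 'M[C]_(m, n)), (forall i, S (row i B)) /\ (v <= B)%MS].

Lemma sub_span_set (S : set 'rV[C]_n) (v : 'rV[C]_n) :
  (v <= span_set S)%MS <->
  exists m (B : 'M[C]_(m, n)), (forall i, S (row i B)) /\ (v <= B)%MS.
Proof.
rewrite /span_set; case: xgetP => [U _ /(_ v) //|nU].
pose Q k := `[< exists m (B : 'M[C]_(m, n)),
                  (forall i, S (row i B)) /\ \rank B = k >].
have exQ : exists k, Q k.
  by exists 0%N; apply/asboolP; exists 0%N, 0; split=> [[]//|]; rewrite mxrank0.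
have leQ k : Q k -> (k <= n)%N.
  by move=> /asboolP[m [B [_ <-]]]; exact: rank_leq_col.
case: (ex_maxnP exQ leQ) => k /asboolP[m [B [SB rB]]] maxk.
exfalso; apply: (nU <<B>>%MS) => w; rewrite genmxE.
split=> [wB|[p [D [SD wD]]]]; first by exists m, B.
have SBD i : S (row i (col_mx B D)).
  by case: (split_ordP i) => j ->; rewrite ?rowKu ?rowKd.
have /maxk : Q (\rank (col_mx B D)).
  by apply/asboolP; exists (m + p)%N, (col_mx B D).
rewrite -rB -addsmxE => rBD.
have /eqmxP eqB : (B == B + D)%MS.
  by rewrite -(geq_leqif (mxrank_leqif_eq (addsmxSl B D))).
by rewrite (submx_trans wD)// eqB addsmxSr.
Qed.

(* 0 <= z in C entails that z is real, so A is self-adjoint. *)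
Definition psdmx m (A : 'M[C]_m) : Prop :=
  forall v : 'rV[C]_m, 0 <= dotmx (v *m A) v.

Definition partial_density (rho : 'M[C]_n) : Prop :=
  psdmx rho /\ \tr rho <= 1.

(* v *m ketbra psi = dotmx v psi *: psi *)
Definition ketbra (psi : 'rV[C]_n) : 'M[C]_n := psi^t* *m psi.

Definition supp (A : 'M[C]_n) : 'M[C]_n :=
  span_set [set v | exists2 a, a != 0 & (v <= eigenspace A a)%MS].

Definition image_space (F : 'M[C]_n -> 'M[C]_n) (X : 'M[C]_n) : 'M[C]_n :=
  span_set [set v | exists2 psi : 'rV[C]_n,
                      (psi <= X)%MS & (v <= supp (F (ketbra psi)))%MS].

Definition orthocompl (X : 'M[C]_n) : 'M[C]_n :=
  orthomx conjC (mx_of_hermitian (hermitian1mx _)) X.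

(* id_k (x) F, on operators on C^k (x) C^n seen as k x k block matrices *)
Definition ampliation k (F : 'M[C]_n -> 'M[C]_n)
    (A : 'M[C]_(\sum_(i < k) n)) : 'M[C]_(\sum_(i < k) n) :=
  \mxblock_(i < k, j < k) F (submxblock A i j).

Definition completely_positive (F : 'M[C]_n -> 'M[C]_n) : Prop :=
  forall k (A : 'M[C]_(\sum_(i < k) n)), psdmx A -> psdmx (ampliation F A).

Definition trace_preserving (F : 'M[C]_n -> 'M[C]_n) : Prop :=
  forall A, \tr (F A) = \tr A.

Definition asymptotic_average (F : 'M[C]_n -> 'M[C]_n) (A : 'M[C]_n) : 'M[C]_n :=
  lim ((N%:R^-1 *: \sum_(1 <= k < N.+1) iter k F A) @[N --> \oo]).

Definition transient (F : 'M[C]_n -> 'M[C]_n) (X : 'M[C]_n) : Prop :=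
  forall rho, partial_density rho ->
    \tr (proj_ortho X *m iter k F rho) @[k --> \oo] --> (0 : C).

End QuantumMarkovChain.

(* Main.v *)
(** Positivity and trace preservation bound all matrix entries of the powers of
    [E], so [ker (E - 1)] and [im (E - 1)] are complementary and the time
    averages converge, with a limit whose values are fixed by [E].
    If [X] is transient, then [tr (P_X rho) = 0] for every fixed positive [rho],
    so [X] is orthogonal to the image [Y] of the average. Conversely, mass never
    leaves [Y]: [tr (P (E^k rho))], where [P] projects onto the complement of
    [Y], decreases with [k], and its time average tends to [0]. *)
Require Import Defs.
From mathcomp Require Import all_boot all_order all_algebra.
From mathcomp Require Import sesquilinear spectral ring.
From mathcomp Require Import complex all_classical all_reals all_analysis.

Import Order.TTheory GRing.Theory Num.Theory Num.Def.
Import numFieldNormedType.Exports.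

Local Open Scope classical_set_scope.
Local Open Scope ring_scope.
Local Open Scope sesquilinear_scope.

(** * Positive semidefinite matrices: trace pairing, Gram factorization, support *)

Section PositiveMatrices.
Context {C : numClosedFieldType} {n : nat}.
Implicit Types (A B : 'M[C]_n) (u v : 'rV[C]_n).

Lemma trmxC_mul m p q (A : 'M[C]_(m, p)) (B : 'M[C]_(p, q)) :
  (A *m B)^t* = B^t* *m A^t*.
Proof. by rewrite trmx_mul map_mxM. Qed.

Lemma quad_tr A v : dotmx (v *m A) v = \tr (A *m ketbra v).
Proof.
by rewrite dotmxE -trace_mx11 mxtrace_mulC mulmxA mxtrace_mulC.
Qed.

Lemma psdmxP A : psdmx A <-> forall v, 0 <= \tr (A *m ketbra v).
Proof. by split=> h v; have := h v; rewrite quad_tr. Qed.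

Lemma psdmxD A B : psdmx A -> psdmx B -> psdmx (A + B).
Proof.
move=> /psdmxP hA /psdmxP hB; apply/psdmxP => v.
by rewrite mulmxDl mxtraceD addr_ge0.
Qed.

Lemma psdmxZ (a : C) A : 0 <= a -> psdmx A -> psdmx (a *: A).
Proof.
move=> ha /psdmxP hA; apply/psdmxP => v.
by rewrite -scalemxAl mxtraceZ mulr_ge0.
Qed.

Lemma psd_gram m (W : 'M[C]_(m, n)) : psdmx (W^t* *m W).
Proof.
move=> v; rewrite dotmxE.
have -> : v *m (W^t* *m W) *m v^t* = (v *m W^t*) *m (v *m W^t*)^t*.
  by rewrite trmxC_mul trmxCK !mulmxA.
by rewrite -dotmxE; exact: (dnorm_ge0 (@dotmx C m)).
Qed.

Lemma gram_sum m (W : 'M[C]_(m, n)) : W^t* *m W = \sum_i ketbra (row i W).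
Proof.
apply/matrixP => i j; rewrite summxE !mxE; apply: eq_bigr => k _.
by rewrite !mxE big_ord1 !mxE.
Qed.

(** Rank-one positive operators span all matrices. This reduces linear identities, bounds and limits
    to positive inputs, where positivity of the channel can be used. *)
Lemma ketbra_ind (P : 'M[C]_n -> Prop) :
  (forall a A B, P A -> P B -> P (a *: A + B)) ->
  (forall v, P (ketbra v)) -> forall A, P A.
Proof.
move=> PD PK; have P0 : P 0.
  by have := PD (-1) _ _ (PK 0) (PK 0); rewrite scaleN1r addNr.
have PZ a A : P A -> P (a *: A) by move=> PA; rewrite -[_ *: _]addr0; exact: PD.
have PB u v : P (u^t* *m v).
  (* Polarization. *)
  have -> : u^t* *m v = 2^-1 *: (1 *: ketbra (u + v) + (- 'i *: ketbra (u + 'i *: v)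
      + (('i - 1) *: ketbra u + ('i - 1) *: ketbra v))).
    apply: (@scalerI _ _ 2%:R); first by rewrite pnatr_eq0.
    rewrite scalerA divff ?pnatr_eq0 // scale1r; apply/matrixP=> i j.
    rewrite !mxE !big_ord1 !mxE !rmorphD !rmorphM /= conjCi.
    have : 'i * 'i = -1 :> C by rewrite -expr2 sqrCi.
    move: ('i : C) (u 0 i)^* (v 0 i)^* (u 0 j) (v 0 j) => I x y z t II.
    ring: II.
  by apply: (PZ); apply: (PD) => //; apply: (PD) => //; apply: (PD) => //; apply: PZ.
move=> A; rewrite [A]matrix_sum_delta.
have Psum (I : finType) (F : I -> 'M[C]_n) : (forall i, P (F i)) -> P (\sum_i F i).
  move=> PF; elim/big_rec: _ => // i B _ PB'; rewrite -[F i]scale1r; exact: PD.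
apply: (Psum) => i; apply: (Psum) => j; apply: PZ.
have -> : delta_mx i j = (delta_mx 0 i : 'rV[C]_n)^t* *m delta_mx 0 j.
  by rewrite trmx_delta map_delta_mx mul_delta_mx.
exact: PB.
Qed.


Lemma mxtrace_delta A i j : \tr (A *m delta_mx j i) = A i j.
Proof.
rewrite /mxtrace (bigD1 i) //= big1 ?addr0 => [|k ki].
  rewrite mxE (bigD1 j) //= big1 ?addr0 => [|k kj].
    by rewrite mxE !eqxx mulr1.
  by rewrite mxE (negPf kj) mulr0.
by rewrite mxE big1 // => l _; rewrite mxE (negPf ki) andbF mulr0.
Qed.

Lemma mxtrace_ext A B : (forall M, \tr (A *m M) = \tr (B *m M)) -> A = B.
Proof.
by move=> AB; apply/matrixP => i j; rewrite -!mxtrace_delta AB.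
Qed.

(** A matrix is determined by its traces against all [ketbra v]. These are real for [A], hence equal
    to those of its adjoint. *)
Lemma psd_hermitian A : psdmx A -> A^t* = A.
Proof.
move=> /psdmxP Apsd; apply: mxtrace_ext; elim/ketbra_ind => [a B1 B2 h1 h2|v].
  by rewrite !mulmxDr -!scalemxAr !mxtraceD !mxtraceZ h1 h2.
have /ger0_real/CrealP := Apsd v; rewrite -mxtrace_tr -trace_map_mx.
by rewrite trmxC_mul /ketbra trmxC_mul trmxCK mxtrace_mulC.
Qed.

(** Take [W] to be the square root of the diagonal part times the unitary of the spectral theorem.
    Its rows are zero for a zero eigenvalue and otherwise multiples of eigenvectors spanning the
    support. *)
Lemma psd_factor A : psdmx A ->
  exists2 W : 'M[C]_n, A = W^t* *m W & (W <= supp A)%MS.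
Proof.
move=> Apsd; have Aherm : A \is hermsymmx.
  by apply/is_hermitianmxP; rewrite expr0 scale1r psd_hermitian.
have /hermitian_normalmx/orthomx_spectralP := Aherm.
set P := spectralmx A; set d := spectral_diag A => AE.
have Pu : P \is unitarymx := spectral_unitarymx A.
have rowPA i : row i P *m A = d 0 i *: row i P.
  rewrite {1}AE !mulmxA -row_mul mulmxV ?unitarymx_unit // row1.
  by rewrite -rowE row_diag_mx -scalemxAl -rowE.
have d_ge0 i : 0 <= d 0 i.
  have := Apsd (row i P); rewrite rowPA linearZl_LR /=.
  by rewrite (row_unitarymxP Pu) eqxx mulr1.
exists (diag_mx (map_mx sqrtC d) *m P).
  rewrite {1}AE trmxC_mul invmx_unitary // !mulmxA -[_ *m _ *m diag_mx _]mulmxA.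
  congr (_ *m _ *m _); rewrite tr_diag_mx map_diag_mx mulmx_diag; congr diag_mx.
  apply/rowP => i; rewrite !mxE /= conj_Creal ?ger0_real ?sqrtC_ge0 //.
  by rewrite -expr2 sqrtCK.
apply/row_subP => i; rewrite row_mul row_diag_mx -scalemxAl -rowE mxE.
have [->|dn0] := eqVneq (d 0 i) 0; first by rewrite sqrtC0 scale0r sub0mx.
apply: scalemx_sub; apply/sub_span_set; exists 1%N, (row i P); split=> // k.
by rewrite row_id; exists (d 0 i) => //; apply/eigenspaceP.
Qed.

(** Replaces the spectral definition of the support by a plain row space, so that images become
    row-space inclusions. *)
Lemma supp_psd A : psdmx A -> (supp A :=: A)%MS.
Proof.
move=> Apsd; apply/eqmxP/andP; split.
  apply/rV_subP => v /sub_span_set[m [B [SB vB]]]; apply: (submx_trans vB).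
  apply/row_subP => i; have [a a0 /eigenspaceP rA] := SB i.
  by rewrite -[row i B](scalerK a0) -rA scalemx_sub // submxMl.
by have [W WE WA] := psd_factor _ Apsd; rewrite {1}WE (submx_trans _ WA) // submxMl.
Qed.

Lemma psd_gramP A : psdmx A -> exists2 W : 'M[C]_n, A = W^t* *m W & (W <= A)%MS.
Proof.
move=> Apsd; have [W WE WA] := psd_factor _ Apsd.
by exists W => //; rewrite -(supp_psd _ Apsd).
Qed.

Lemma tr_mul_psd_ge0 A B : psdmx A -> psdmx B -> 0 <= \tr (A *m B).
Proof.
move=> /psdmxP Apsd /psd_gramP[W -> _].
rewrite gram_sum mulmx_sumr raddf_sum sumr_ge0 //= => i _; exact: Apsd.
Qed.

Lemma tr_ketbra v : \tr (ketbra v) = dotmx v v.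
Proof. by rewrite mxtrace_mulC trace_mx11 dotmxE. Qed.

Lemma psd_ketbra v : psdmx (ketbra v).
Proof. exact: psd_gram. Qed.

Lemma tr_psd_ge0 A : psdmx A -> 0 <= \tr A.
Proof.
move=> /psd_gramP[W -> _]; rewrite gram_sum raddf_sum sumr_ge0 //= => i _.
by rewrite tr_ketbra (dnorm_ge0 (@dotmx C n)).
Qed.

(** By Cauchy-Schwarz, [dotmx v v *: 1%:M - ketbra v] is positive. *)
Lemma tr_ketbra_le v A : psdmx A -> \tr (ketbra v *m A) <= dotmx v v * \tr A.
Proof.
move=> Apsd; rewrite -subr_ge0 -mxtraceZ -mul_scalar_mx -raddfB -mulmxBl.
apply: tr_mul_psd_ge0 => // u.
rewrite mulmxBr mul_mx_scalar linearBl linearZl_LR /= subr_ge0.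
have -> : dotmx (u *m ketbra v) u = `|dotmx u v| ^+ 2.
  rewrite mulmxA {1}[u *m _]mx11_scalar mul_scalar_mx linearZl_LR /= -dotmxE.
  rewrite normCK !dotmxE; congr (_ * _).
  have -> : v *m u^t* = (u *m v^t*)^t* by rewrite trmxC_mul trmxCK.
  by rewrite [LHS]mxE [X in conjC X]mxE.
by rewrite mulrC; exact: CauchySchwarz.
Qed.
End PositiveMatrices.

(** The case of a one-dimensional ancilla: a single-block matrix has the same quadratic form as its
    block. *)
Lemma completely_positive_psd {C : numClosedFieldType} {n : nat}
    (F : 'M[C]_n -> 'M[C]_n) A :
  completely_positive F -> psdmx A -> psdmx (F A).
Proof.
move=> Fcp Apsd u.
have dot1 (B : 'M[C]_n) (v w : 'rV[C]_n) :
    dotmx ((\mxrow_(_ < 1) v) *m \mxblock_(i < 1, j < 1) B) (\mxrow_(_ < 1) w) =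
    dotmx (v *m B) w.
  rewrite mul_mxrow_mxblock !dotmxE.
  have -> : (\mxrow_(_ < 1) w)^t* = \mxcol_(_ < 1) w^t*.
    by apply/matrixP => i j; rewrite !mxE.
  rewrite mul_mxrow_mxcol.
  by rewrite !big_ord1.
have Bpsd : psdmx (\mxblock_(i < 1, j < 1) A).
  move=> v; rewrite -[v]submxrowK (eq_mxrow (B_ := fun=> submxrow v 0)) ?dot1 //.
  by move=> j; rewrite ord1.
have := Fcp _ _ Bpsd (\mxrow_(_ < 1) u).
rewrite /ampliation (eq_mxblock (B_ := fun _ _ => F A)) ?dot1 // => i j.
by rewrite mxblockK.
Qed.

Lemma cvg_mx_coord {T : Type} {F : set_system T} {FF : Filter F}
    {K : topologicalType} {m n : nat} (f : T -> 'M[K]_(m, n)) (M : 'M[K]_(m, n)) :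
  (forall i j, f x i j @[x --> F] --> M i j) -> f x @[x --> F] --> M.
Proof.
move=> fM A [P MP sPA].
have : \forall x \near F, forall i j, P i j (f x i j).
  by apply: filter_forall => i; apply: filter_forall => j; exact: fM (MP i j).
by apply: filterS => x Px; exact: sPA.
Qed.

(** * Mean ergodic theorem for positive trace-preserving maps *)

Section MeanErgodic.
Context {C : numClosedFieldType} {n : nat} (E : {linear 'M[C]_n -> 'M[C]_n}).
Context (arch : forall x : C, exists k, `|x| < k%:R).
Context (Epos : forall A, psdmx A -> psdmx (E A)).
Context (Etr : trace_preserving E).
Implicit Types (A B Q : 'M[C]_n).

Lemma iter_linear k a A B :
  iter k E (a *: A + B) = a *: iter k E A + iter k E B.
Proof. by elim: k => //= k ->; rewrite linearP. Qed.

Lemma iter_psd k A : psdmx A -> psdmx (iter k E A).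
Proof. by move=> Apsd; elim: k => //= k; exact: Epos. Qed.

Lemma iter_tr k A : \tr (iter k E A) = \tr A.
Proof. by elim: k => //= k; rewrite Etr. Qed.

(** For [Q] and [A] of the form [ketbra], the trace is nonnegative and bounded through the trace of
    the iterate, which is constant in [k]. Bilinearity extends this to all matrices. *)
Lemma iter_bounded Q A : exists c, forall k, `|\tr (Q *m iter k E A)| <= c.
Proof.
elim/(@ketbra_ind C n): Q => [a Q1 Q2 [c1 h1] [c2 h2]|u].
  exists (`|a| * c1 + c2) => k.
  rewrite mulmxDl -scalemxAl mxtraceD mxtraceZ (le_trans (ler_normD _ _)) //.
  by rewrite normrM lerD // ler_wpM2l.
elim/(@ketbra_ind C n): A => [a A1 A2 [c1 h1] [c2 h2]|v].
  exists (`|a| * c1 + c2) => k.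
  rewrite iter_linear mulmxDr -scalemxAr mxtraceD mxtraceZ.
  by rewrite (le_trans (ler_normD _ _)) // normrM lerD // ler_wpM2l.
exists (dotmx u u * \tr (ketbra v)) => k.
have vpsd := iter_psd k _ (psd_ketbra v).
rewrite ger0_norm ?tr_mul_psd_ge0 //; last exact: psd_ketbra.
by rewrite -(iter_tr k (ketbra v)) tr_ketbra_le.
Qed.

Lemma bounded_mul_eq0 (c x : C) : (forall k : nat, `|x| * k%:R <= c) -> x = 0.
Proof.
move=> xc; apply/eqP; rewrite -normr_eq0; apply/negPn/negP => x0.
have x_gt0 : 0 < `|x| by rewrite lt_def x0 normr_ge0.
have c0 : 0 <= c by have := xc 0%N; rewrite mulr0.
have [k] := arch (c / `|x|).
rewrite ger0_norm ?divr_ge0 // ltr_pdivrMr // mulrC => /lt_le_trans/(_ (xc k)).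
by rewrite ltxx.
Qed.

(* A fixed point of the form [E B - B] vanishes, since [iter k E B = B + k A]
   stays bounded; by rank-nullity the two spaces are then complementary. *)
Lemma ergodic_decomposition A : exists F B, E F = F /\ A = F + (E B - B).
Proof.
(* On vectorized operators [G] represents [E - 1]: its left kernel encodes the fixed points and its
   row space the differences [E B - B]. *)
pose G : 'M[C]_(n * n) := lin_mx E - 1%:M.
have GE B : mxvec B *m G = mxvec (E B - B).
  by rewrite mulmxBr mulmx1 mul_vec_lin linearB.
have fix_im0 M B : E M = M -> M = E B - B -> M = 0.
  move=> EM MB; apply: mxtrace_ext => Q; rewrite mul0mx mxtrace0 mxtrace_mulC.
  have [c cP] := iter_bounded Q B.
  apply: (@bounded_mul_eq0 (c + `|\tr (Q *m B)|)) => k.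
  have iterB : iter k E B = B + M *+ k.
    elim: k => [|k IH]; first by rewrite mulr0n addr0.
    by rewrite /= IH linearD linearMn /= EM mulrS addrA MB addrCA subrr addr0.
  have -> : `|\tr (Q *m M)| * k%:R = `|\tr (Q *m iter k E B) - \tr (Q *m B)|.
    rewrite iterB mulmxDr mxtraceD addrC addKr -scaler_nat -scalemxAr mxtraceZ.
    by rewrite normrM normr_nat mulrC.
  by rewrite (le_trans (ler_normB _ _)) // lerD.
have cap0 : (kermx G :&: G)%MS = 0.
  apply/eqP/rowV0P => v; rewrite sub_capmx => /andP[/sub_kermxP vG /submxP[w vw]].
  rewrite -[v]vec_mxK (@fix_im0 (vec_mx v) (vec_mx w)) ?linear0 //.
    apply/eqP; rewrite -subr_eq0; apply/eqP.
    by apply: (can_inj mxvecK); rewrite -GE vec_mxK vG linear0.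
  by apply: (can_inj mxvecK); rewrite -GE !vec_mxK.
have full : (1%:M <= kermx G + G)%MS.
  rewrite sub1mx /row_full; have := mxrank_sum_cap (kermx G) G.
  by rewrite cap0 mxrank0 addn0 => ->; rewrite mxrank_ker subnK ?rank_leq_row.
have /sub_addsmxP[[u w] /= Avec] := submx_trans (submx1 (mxvec A)) full.
exists (vec_mx (u *m kermx G)), (vec_mx w); split.
  apply/eqP; rewrite -subr_eq0; apply/eqP.
  by apply: (can_inj mxvecK); rewrite -GE vec_mxK -mulmxA mulmx_ker mulmx0 linear0.
by apply: (can_inj mxvecK); rewrite linearD /= -GE !vec_mxK.
Qed.

Definition time_average A (N : nat) : 'M[C]_n :=
  N%:R^-1 *: \sum_(1 <= k < N.+1) iter k E A.

Lemma cvg_invn_bounded (f g : nat -> C) (a c : C) :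
  (forall N, (0 < N)%N -> f N = a + N%:R^-1 * g N) -> (forall N, `|g N| <= c) ->
  f N @[N --> \oo] --> a.
Proof.
move=> fE gc; apply/cvgrPdist_le => e e0; have [k kP] := arch (c / e).
have c0 : 0 <= c := le_trans (normr_ge0 _) (gc 0%N).
(* The successor keeps [N] positive even when [k] is zero, as the formula for [f] requires. *)
exists k.+1 => // N /= kN; have N0 : (0 < N)%N := leq_ltn_trans (leq0n _) kN.
rewrite fE // opprD addrA subrr sub0r normrN normrM normfV normr_nat.
rewrite mulrC ler_pdivrMr ?ltr0n // (le_trans (gc N)) // -ler_pdivrMl // mulrC.
rewrite (le_trans _ (ltW (lt_le_trans kP _))) //; last by rewrite ler_nat ltnW.
by rewrite ger0_norm // divr_ge0 // ltW.
Qed.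

(** The fixed part averages to itself and the sum over [E B - B] telescopes. As the sum starts at
    [k = 1], the lower end is [E B] rather than [B]. *)
Lemma time_averageE F B N : E F = F -> (0 < N)%N ->
  time_average (F + (E B - B)) N = F + N%:R^-1 *: (iter N.+1 E B - E B).
Proof.
move=> EF N0.
have iterF k : iter k E F = F by elim: k => //= k ->.
have -> : iter N.+1 E B - E B = \sum_(1 <= k < N.+1) (iter k.+1 E B - iter k E B).
  by rewrite (telescope_sumr (fun k => iter k E B)).
have FE : N%:R^-1 *: \sum_(1 <= k < N.+1) F = F.
  rewrite sumr_const_nat subn1 -[F *+ _]scaler_nat scalerA mulVf ?scale1r //.
  by rewrite pnatr_eq0 -lt0n.
rewrite -[X in _ = X + _]FE -scalerDr -big_split /=; congr (_ *: _).
apply: eq_bigr => k _.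
have iterD X Y : iter k E (X + Y) = iter k E X + iter k E Y.
  by rewrite -[X]scale1r iter_linear !scale1r.
have iterB X Y : iter k E (X - Y) = iter k E X - iter k E Y.
  by rewrite addrC -scaleN1r iter_linear scaleN1r addrC.
by rewrite iterD iterB iterF -iterSr.
Qed.

Lemma time_average_cvg A : exists2 F, E F = F &
  forall Q, \tr (Q *m time_average A N) @[N --> \oo] --> \tr (Q *m F).
Proof.
have [F [B [EF ->]]] := ergodic_decomposition A; exists F => // Q.
have [c cP] := iter_bounded Q B.
apply: (@cvg_invn_bounded _ (fun N => \tr (Q *m (iter N.+1 E B - E B))) _ (c + c)) => N.
  by move=> N0; rewrite time_averageE // mulmxDr -scalemxAr mxtraceD mxtraceZ.
rewrite mulmxBr raddfB (le_trans (ler_normB _ _)) // lerD //; first exact: (cP N.+1).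
exact: (cP 1%N).
Qed.

(** Pairing with [delta_mx j i] extracts an entry, so weak convergence gives entrywise convergence
    and identifies the limit with the fixed part of the ergodic decomposition. *)
Lemma asymptotic_averageP A : E (asymptotic_average E A) = asymptotic_average E A /\
  forall Q, \tr (Q *m time_average A N) @[N --> \oo] --> \tr (Q *m asymptotic_average E A).
Proof.
have [F EF Fcvg] := time_average_cvg A.
suff -> : asymptotic_average E A = F by [].
apply/cvg_lim; first exact: norm_hausdorff.
apply: cvg_mx_coord => i j.
have := Fcvg (delta_mx j i); rewrite mxtrace_mulC mxtrace_delta.
by under eq_cvg do rewrite mxtrace_mulC mxtrace_delta.
Qed.

Lemma asymptotic_average_psd A : psdmx A -> psdmx (asymptotic_average E A).
Proof.
move=> Apsd; apply/psdmxP => v; rewrite mxtrace_mulC.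
have [_ /(_ (ketbra v)) cv] := asymptotic_averageP A.
have pos N : 0 <= \tr (ketbra v *m time_average A N).
  apply: tr_mul_psd_ge0; first exact: psd_ketbra.
  apply: psdmxZ; first by rewrite invr_ge0.
  elim/big_ind: _ => [|X Y|k _]; [|exact: psdmxD|exact: iter_psd].
  by move=> u; rewrite mulmx0 linear0l.
(* The traces equal their own norms, so by uniqueness of limits the limit equals its norm and is
   nonnegative. *)
have := cvg_norm cv.
rewrite (_ : (fun x => _) = (fun N => \tr (ketbra v *m time_average A N))); last first.
  by apply/funext => N; rewrite ger0_norm.
by move=> cvn; rewrite (cvg_unique (@norm_hausdorff _ C) cv (cvn _)) normr_ge0.
Qed.
End MeanErgodic.

(** * Orthogonal projections, the image of the average, and transience *)

Section LargestTransient.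
Context {C : numClosedFieldType} {n : nat}.
Implicit Types (A B M X Z : 'M[C]_n) (u v : 'rV[C]_n).

Lemma gram_tr_eq0 {m} (W : 'M[C]_(m, n)) : \tr (W^t* *m W) = 0 -> W = 0.
Proof.
rewrite gram_sum raddf_sum => /psumr_eq0P W0; apply/row_matrixP => i.
rewrite row0; apply/eqP; rewrite -(dnorm_eq0 (@dotmx C n)) /= -tr_ketbra; apply/eqP.
by apply: W0 => // j _; rewrite /= tr_ketbra (dnorm_ge0 (@dotmx C n)).
Qed.

(** With [M] factored as [V^t* *m V], the trace is the squared Hilbert-Schmidt norm of
    [W *m V^t*]. *)
Lemma psd_tr_gram_eq0 {m} M (W : 'M[C]_(m, n)) :
  psdmx M -> \tr (M *m (W^t* *m W)) = 0 -> W *m M = 0.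
Proof.
move=> /psd_gramP[V -> _] tr0; suff W0 : W *m V^t* = 0 by rewrite mulmxA W0 mul0mx.
apply: gram_tr_eq0; rewrite trmxC_mul trmxCK -[RHS]tr0.
by rewrite -mulmxA [RHS]mxtrace_mulC !mulmxA mxtrace_mulC !mulmxA.
Qed.

(** The range of [1%:M - P] is orthogonal to that of [P], hence [P^t* = P *m P^t*], and the
    right-hand side is self-adjoint. *)
Lemma proj_ortho_hermitian X : (proj_ortho X)^t* = proj_ortho X.
Proof.
set P := proj_ortho X.
have /orthomx1P : (1%:M - P <= orthomx conjC (mx_of_hermitian (hermitian1mx n)) P)%MS.
  by rewrite (eqmx_ortho _ (proj_orthoE X)) -[P]mul1mx proj_ortho_compl_sub.
rewrite mulmxBl mul1mx => /eqP; rewrite subr_eq0 => /eqP PP.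
have : (P^t*)^t* = (P *m P^t*)^t* by rewrite -PP.
by rewrite (trmxC_mul _ _ _ P) trmxCK -PP.
Qed.

Lemma proj_ortho_psd X : psdmx (proj_ortho X).
Proof.
by rewrite -[X in psdmx X]proj_ortho_proj -{1}proj_ortho_hermitian; exact: psd_gram.
Qed.

Lemma image_space_sub (F : 'M[C]_n -> 'M[C]_n) Z :
  (forall A, psdmx A -> psdmx (F A)) ->
  (image_space F 1%:M <= Z)%MS <-> forall v, (F (ketbra v) <= Z)%MS.
Proof.
move=> Fpos; have Fpsd v := Fpos _ (psd_ketbra v); split=> [FZ v|FZ].
  apply: submx_trans FZ; apply/row_subP => i; apply/sub_span_set.
  exists 1%N, (row i (F (ketbra v))); split=> // j.
  by rewrite row_id; exists v; rewrite ?submx1 // (supp_psd _ (Fpsd v)) row_sub.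
apply/rV_subP => v /sub_span_set[m [B [SB vB]]]; apply: (submx_trans vB).
apply/row_subP => i; have [u _] := SB i.
by rewrite (supp_psd _ (Fpsd u)) => /submx_trans; apply.
Qed.

(** [M] is the Heisenberg-picture image of [A]: the adjoint of [F] for the trace pairing, applied to
    [A]. *)
Lemma trace_dual (F : {linear 'M[C]_n -> 'M[C]_n}) A :
  exists M, forall B, \tr (M *m B) = \tr (A *m F B).
Proof.
exists (\matrix_(i, j) \tr (A *m F (delta_mx j i))) => B.
have -> : F B = \sum_i \sum_j B i j *: F (delta_mx i j).
  rewrite {1}[B]matrix_sum_delta linear_sum; apply: eq_bigr => i _.
  by rewrite linear_sum; apply: eq_bigr => j _; rewrite linearZ.
rewrite {1}[B]matrix_sum_delta !mulmx_sumr !raddf_sum; apply: eq_bigr => i _.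
rewrite !mulmx_sumr !raddf_sum; apply: eq_bigr => j _ /=.
by rewrite -!scalemxAr !mxtraceZ mxtrace_delta mxE.
Qed.

Context (E : {linear 'M[C]_n -> 'M[C]_n}).
Context (arch : forall x : C, exists k, `|x| < k%:R).
Context (Epos : forall A, psdmx A -> psdmx (E A)).
Context (Etr : trace_preserving E).

Local Notation Einf := (asymptotic_average E).
Local Notation Y := (image_space Einf 1%:M).
Local Notation T := (orthocompl Y).

Let Einf_psd A : psdmx A -> psdmx (Einf A).
Proof. exact: asymptotic_average_psd. Qed.

Let Einf_fix A : E (Einf A) = Einf A.
Proof. by have [] := asymptotic_averageP E arch Epos Etr A. Qed.

Lemma transient_sub_orthocompl X : transient E X -> (X <= T)%MS.
Proof.
move=> Xtr; rewrite /orthocompl orthomx_sym.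
apply/image_space_sub => // v; have rpsd := Einf_psd _ (psd_ketbra v).
set r := Einf _ in rpsd *; have [W rE _] := psd_gramP _ rpsd.
(* If the projection kills [W], then [W] equals its own component orthogonal to [X], and the row
   space of [r] lies in that of [W]. *)
suff W0 : W *m proj_ortho X = 0.
  by rewrite rE mulmx_sub // -[W]subr0 -W0 proj_ortho_compl_sub.
apply: psd_tr_gram_eq0; rewrite -?rE; first exact: proj_ortho_psd.
have t_ge0 := tr_psd_ge0 _ rpsd; set t := \tr r in t_ge0.
have t1_gt0 : 0 < 1 + t by rewrite ltr_pwDl.
(* Dividing by [1 + t] instead of [t] brings the trace below one without a separate case for
   [t = 0]. *)
have rdens : partial_density ((1 + t)^-1 *: r).
  split; first by apply: psdmxZ => //; rewrite invr_ge0 ltW.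
  by rewrite mxtraceZ ler_pdivrMl // mulr1 lerDr.
have iterE k : iter k E ((1 + t)^-1 *: r) = (1 + t)^-1 *: r.
  by elim: k => //= k ->; rewrite linearZ /= Einf_fix.
pose x := \tr (proj_ortho X *m ((1 + t)^-1 *: r)).
have x0 : x @[_ --> \oo] --> (0 : C).
  by apply: cvg_trans (Xtr _ rdens); apply: near_eq_cvg; near=> k; rewrite iterE.
have xx : x @[_ --> \oo] --> x by exact: cvg_cst.
have x_eq0 : x = 0 by exact: (cvg_unique (@norm_hausdorff _ C) xx x0).
move/eqP: x_eq0.
rewrite /x -scalemxAr mxtraceZ mulf_eq0 invr_eq0 gt_eqF //=.
by move=> /eqP.
Unshelve. all: by end_near.
Qed.

Let P := proj_ortho T.

Lemma proj_orthocompl_image v : \tr (P *m Einf (ketbra v)) = 0.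
Proof.
have [W rE Wr] := psd_gramP _ (Einf_psd _ (psd_ketbra v)).
have WY : (W <= Y)%MS.
  by apply: (submx_trans Wr); have /image_space_sub -> := submx_refl Y.
rewrite rE mulmxA mxtrace_mulC mulmxA proj_ortho_0 ?mul0mx ?mxtrace0 //.
by rewrite (submx_trans WY) // ortho_mx_ortho.
Qed.

(* Mass outside [Y] never increases: the dual [M] of [P] satisfies [M <= 1] and
   kills [Y], hence [M = P M P <= P]. *)
Lemma proj_orthocompl_decr A : psdmx A -> \tr (P *m E A) <= \tr (P *m A).
Proof.
move=> Apsd; have [M ME] := trace_dual E P.
have Mpsd : psdmx M.
  apply/psdmxP => v; rewrite ME tr_mul_psd_ge0 //; first exact: proj_ortho_psd.
  exact: Epos (psd_ketbra v).
(* Values of the average are fixed by [E], so pairing them with [M] is the same as pairing them with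
   [P], which gives zero. *)
have YM : (Y <= kermx M)%MS.
  apply/image_space_sub => // v.
  have [W rE _] := psd_gramP _ (Einf_psd _ (psd_ketbra v)).
  apply/sub_kermxP; rewrite rE -mulmxA (psd_tr_gram_eq0 M) ?mulmx0 //.
  by rewrite -rE ME Einf_fix proj_orthocompl_image.
rewrite -ME -subr_ge0 -raddfB -mulmxBl tr_mul_psd_ge0 //= => v.
rewrite mulmxBr linearBl /= subr_ge0.
(* The component of [v] orthogonal to [T] lies in the double complement of [Y], which is [Y]
   itself. *)
have yM : (v - v *m P) *m M = 0.
  apply/sub_kermxP; apply: submx_trans YM.
  by rewrite (submx_trans (proj_ortho_compl_sub _ _)) // ortho_id.
have vM : v *m M = v *m P *m M.
  by apply/eqP; rewrite -subr_eq0 -mulmxBl yM.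
have -> : dotmx (v *m M) v = dotmx (v *m P *m M) (v *m P).
  apply/eqP; rewrite vM -subr_eq0 -linearBr /= dotmxE -mulmxA.
  by rewrite -[M]psd_hermitian // -trmxC_mul yM trmx0 map_mx0 mulmx0 mxE.
have -> : dotmx (v *m P) v = dotmx (v *m P) (v *m P).
  rewrite !dotmxE trmxC_mul proj_ortho_hermitian mulmxA -[_ *m P *m P]mulmxA.
  by rewrite proj_ortho_proj.
have Cpsd : psdmx (1%:M - P).
  have -> : 1%:M - P = (1%:M - P)^t* *m (1%:M - P).
    have -> : (1%:M - P)^t* = 1%:M - P.
      by rewrite [_^T]linearB /= map_mxB trmx1 map_mx1 proj_ortho_hermitian.
    by rewrite mulmxBl mul1mx mulmxBr mulmx1 proj_ortho_proj subrr subr0.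
  exact: psd_gram.
(* This is [M <= 1] tested on [v *m P]: by trace preservation the gap is the trace of [1%:M - P]
   against a positive operator. *)
rewrite quad_tr ME -tr_ketbra -[X in _ <= X]Etr -subr_ge0 -raddfB /=.
rewrite -{1}[E _]mul1mx -mulmxBl tr_mul_psd_ge0 //.
exact: Epos (psd_ketbra _).
Qed.

Lemma orthocompl_transient : transient E T.
Proof.
move=> rho _; elim/(@ketbra_ind C n): rho => [a A B hA hB|v].
  rewrite -[0](addr0 (0 : C)) -{1}[0](mulr0 a).
  under eq_cvg do rewrite iter_linear mulmxDr -scalemxAr mxtraceD mxtraceZ.
  by apply: cvgD hB; apply: cvgM hA; exact: cvg_cst.
have [_ /(_ P)] := asymptotic_averageP E arch Epos Etr (ketbra v).
rewrite proj_orthocompl_image => /cvgr0Pnorm_le mean0; apply/cvgr0Pnorm_le => e e0.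
have kpsd k := iter_psd E Epos k _ (psd_ketbra v).
pose a k := \tr (P *m iter k E (ketbra v)).
have a_ge0 k : 0 <= a k by apply: tr_mul_psd_ge0 => //; exact: proj_ortho_psd.
have a_decr k j : a (j + k)%N <= a k.
  elim: j => // j; exact: le_trans (proj_orthocompl_decr _ (kpsd _)).
near=> N; have N0 : (0 < N)%N by near: N; exact: nbhs_infty_gt.
(* Since [a] is nonincreasing, its term [a N] is at most the mean of the terms from 1 to [N]. *)
suff aN : `|a N| <= `|\tr (P *m time_average E (ketbra v) N)|.
  by apply: (le_trans aN); near: N; exact: mean0.
rewrite /time_average -scalemxAr mxtraceZ mulmx_sumr raddf_sum /=.
rewrite normrM normfV normr_nat ler_pdivlMl ?ltr0n //.
rewrite (ger0_norm (a_ge0 N)) ger0_norm; last by apply: sumr_ge0 => k _; exact: a_ge0.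
have -> : N%:R * a N = \sum_(1 <= k < N.+1) a N.
  by rewrite sumr_const_nat subn1 mulr_natl.
apply: ler_sum_nat => k /andP[_ kN]; rewrite -[N](subnK (kN : (k <= N)%N)).
exact: a_decr.
Unshelve. all: by end_near.
Qed.
End LargestTransient.

Theorem theorem4 (R : realType) (n : nat) (hn : (0 < n)%N)
    (E : {linear 'M[R[i]]_n -> 'M[R[i]]_n})
    (hCP : completely_positive E) (hTP : trace_preserving E) :
  let T := orthocompl (image_space (asymptotic_average E) 1%:M) in
  transient E T /\
  (forall X : 'M[R[i]]_n, transient E X -> (X <= T)%MS).
Proof.
(* The norm of a complex number is an embedded real, so the Archimedean bound of [R] carries
   over. *)
have arch (x : R[i]) : exists k : nat, `|x| < k%:R.
  rewrite normc_def; set r := Num.sqrt _; exists (Num.bound r).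
  by rewrite -(rmorph_nat (@real_complex R)) ltcR archi_boundP ?sqrtr_ge0.
have Epos A : psdmx A -> psdmx (E A) by exact: completely_positive_psd.
split; first exact: orthocompl_transient.
exact: transient_sub_orthocompl.
Qed.
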